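(* Let $(a_i)_{i\in\mathbb{Z}}$ be the quiddity row of an infinite frieze $\mathcal{F}=(m_{ij})_{j-i\ge-2}$. Then, for all $j\ge i$: a) $\displaystyle a_j=\frac{m_{ij}+m_{i,j-2}}{m_{i,j-1}}$ and $\displaystyle a_i=\frac{m_{ij}+m_{i+2,j}}{m_{i+1,j}}$; b) $\displaystyle m_{ij}=\det\begin{pmatrix}a_i&1&&&0\\ 1&a_{i+1}&1&&\\ &\ddots&\ddots&\ddots&\\ &&1&a_{j-1}&1\\ 0&&&1&a_j\end{pmatrix}$, the determinant of the tridiagonal $(j-i+1)\times(j-i+1)$ matrix with diagonal entries $a_i,a_{i+1},\dots,a_j$, all entries directly above and below the diagonal equal to $1$, and all other entries $0$.
   Context: An infinite frieze is an array $(m_{ij})_{i,j\in\mathbb{Z},\,j-i\ge -2}$ of integers with $m_{i,i-2}=0$ and $m_{i,i-1}=1$ for all $i\in\mathbb{Z}$, $m_{ij}>0$ for all $j\ge i$, and $m_{ij}m_{i+1,j+1}-m_{i+1,j}m_{i,j+1}=1$ for all $j-i\ge -1$. Its quiddity row is the sequence $(a_i)_{i\in\mathbb{Z}}$ with $a_i=m_{ii}$. *)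

(* Defs.v *)
From mathcomp Require Import all_boot all_order all_algebra.

Set Implicit Arguments.
Unset Strict Implicit.
Unset Printing Implicit Defensive.

Import Order.TTheory GRing.Theory Num.Theory.
Local Open Scope ring_scope.

(* The array is indexed by the pairs (i, j) with j - i >= -2. It is encoded as
   a total function; its values at the other pairs are unconstrained. *)
Record infinite_frieze (m : int -> int -> int) : Prop := InfiniteFrieze {
  frieze_zeros : forall i : int, m i (i - 2) = 0;
  frieze_ones : forall i : int, m i (i - 1) = 1;
  frieze_pos : forall i j : int, i <= j -> 0 < m i j;
  frieze_diamond : forall i j : int, -1 <= j - i ->
    m i j * m (i + 1) (j + 1) - m (i + 1) j * m i (j + 1) = 1
}.

Definition quiddity_row (m : int -> int -> int) (i : int) : int := m i i.

(* Rows and columns are numbered from 0, so the diagonal entries are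
   a_i, a_(i+1), ..., a_(i+n-1). *)
Definition tridiag_mx (a : int -> int) (i : int) (n : nat) : 'M[int]_n :=
  \matrix_(k < n, l < n)
    if k == l then a (i + k%:Z)
    else if (k.+1 == l :> nat) || (l.+1 == k :> nat) then 1 else 0.

(* Main.v *)
Require Import Defs.
From mathcomp Require Import all_boot all_order all_algebra.
From mathcomp Require Import zify.

Import Order.TTheory GRing.Theory Num.Theory.
Local Open Scope ring_scope.

(** Both formulas in a) go by induction on [j - i]: subtracting two adjacent
    diamond relations shows that the ratio [(m_ij + m_(i,j-2)) / m_(i,j-1)]
    does not change when [i] is replaced by [i + 1], as long as the entries
    involved are positive, and for [i = j] it equals [a_j]; the other ratio is
    treated symmetrically.  Expanding the tridiagonal determinant along its
    first row gives the same three-term recurrence as the second formula,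
    which yields b). *)

(** The row of ones is included because the denominators in a) lie in it when [i = j]. *)
Lemma frieze_gt0 {m : int -> int -> int} (hm : infinite_frieze m)
  (i j : int) : i - 1 <= j -> 0 < m i j.
Proof.
move=> le_ij; have [le|lt] := leP i j; first exact: (frieze_pos hm).
have -> : j = i - 1 by lia.
by rewrite (frieze_ones hm) ltr01.
Qed.

Lemma frieze_diamond_prev {m : int -> int -> int} (hm : infinite_frieze m)
  (i j : int) :
  i <= j -> m i (j - 1) * m (i + 1) j - m (i + 1) (j - 1) * m i j = 1.
Proof.
by move=> le_ij; have := @frieze_diamond m hm i (j - 1); rewrite subrK; apply; lia.
Qed.

(* The difference of two adjacent diamond relations, solved for a ratio. *)
Lemma diamond_ratio {x y z u v w c : int} :
  w + v = c * y -> y != 0 -> x * w - y * z = 1 -> u * y - v * x = 1 ->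
  z + u = c * x.
Proof.
(* Times [y], the left side is [(x * w - 1) + (1 + v * x) = x * (w + v)]. *)
move=> wv y_neq0 xw uy; apply: (mulfI y_neq0).
have -> : y * (c * x) = x * (w + v) by rewrite wv; lia.
lia.
Qed.

Lemma frieze_recr {m : int -> int -> int} (hm : infinite_frieze m) (i j : int) :
  i <= j -> m i j + m i (j - 2) = m j j * m i (j - 1).
Proof.
move=> le_ij; have [n def_i] : exists n : nat, i = j - n%:Z
  by exists `|(j - i)%R|%N; lia.
elim: n i def_i {le_ij} => [|n IHn] i def_i.
  have -> : i = j by lia.
  by rewrite (frieze_zeros hm) (frieze_ones hm) addr0 mulr1.
(* With [j] fixed, the ratio at [i + 1] passes to [i] through the diamonds whose last columns are
   [j] and [j - 1]. *)
apply: (diamond_ratio (IHn (i + 1) _)); first by lia.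
- by apply: lt0r_neq0; apply: (frieze_gt0 hm); lia.
- by apply: (frieze_diamond_prev hm); lia.
- have := frieze_diamond_prev hm i (j - 1).
  have -> : j - 1 - 1 = j - 2 by lia.
  by move=> ->; lia.
Qed.

Lemma frieze_recl {m : int -> int -> int} (hm : infinite_frieze m) (i j : int) :
  i <= j -> m i j + m (i + 2) j = m i i * m (i + 1) j.
Proof.
move=> le_ij; have [n def_j] : exists n : nat, j = i + n%:Z
  by exists `|(j - i)%R|%N; lia.
elim: n j def_j {le_ij} => [|n IHn] j def_j.
  have := frieze_zeros hm (i + 2); have := frieze_ones hm (i + 1).
  have -> : j = i by lia.
  by rewrite !addrK => -> ->; rewrite addr0 mulr1.
have D1 : m i (j - 1) * m (i + 1) j - m (i + 1) (j - 1) * m i j = 1.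
  by apply: (frieze_diamond_prev hm); lia.
have := frieze_diamond_prev hm (i + 1) j.
have -> : i + 1 + 1 = i + 2 by lia.
move=> D2.
apply: (diamond_ratio (IHn (j - 1) _)); first by lia.
- by apply: lt0r_neq0; apply: (frieze_gt0 hm); lia.
- by rewrite [X in X - _]mulrC.
- by rewrite [X in X - _]mulrC D2 //; lia.
Qed.

Lemma det_tridiag_mx_rec (a : int -> int) (i : int) (n : nat) :
  \det (tridiag_mx a i n.+2) =
    a i * \det (tridiag_mx a (i + 1) n.+1) - \det (tridiag_mx a (i + 2) n).
Proof.
rewrite (expand_det_row _ ord0) 2!big_ord_recl /= big1 ?addr0; last first.
  by move=> k _; rewrite mxE /= mul0r.
rewrite !mxE /= addr0 /cofactor expr0 expr1 !mul1r mulN1r; congr (_ * \det _ - _).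
  apply/matrixP=> k l; rewrite !mxE (inj_eq lift_inj) /= /bump /= !add1n !eqSS.
  by congr (if _ then a _ else _); lia.
(* The minor of the off-diagonal 1 in the first row has first column [(1, 0, ..., 0)], so expanding
   along it leaves the matrix that starts at [i + 2]. *)
rewrite (expand_det_col _ ord0) big_ord_recl /= big1 ?addr0; last first.
  by move=> k _; rewrite !mxE /= mul0r.
rewrite !mxE /= mul1r /cofactor expr0 mul1r; congr (\det _).
apply/matrixP=> k l; rewrite !mxE /=.
rewrite -!(inj_eq val_inj) /= /bump /= !add1n !eqSS.
by congr (if _ then a _ else _); lia.
Qed.

(** Indexing by the matrix size [n] admits [n = 0], where the empty determinant matches the row of
    ones; the second-order recurrence needs this base case besides [n = 1]. *)
Lemma frieze_det {m : int -> int -> int} (hm : infinite_frieze m)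
  (n : nat) (i : int) :
  m i (i + n%:Z - 1) = \det (tridiag_mx (quiddity_row m) i n).
Proof.
elim/ltn_ind: n i => -[|[|n]] IHn i.
- by rewrite det_mx00 addr0 (frieze_ones hm).
- by rewrite det_mx11 mxE /= addr0 addrK.
rewrite det_tridiag_mx_rec -!IHn // /quiddity_row.
set j := i + n.+2%:Z - 1.
have -> : i + 1 + n.+1%:Z - 1 = j by lia.
have -> : i + 2 + n%:Z - 1 = j by lia.
by rewrite -(frieze_recl hm) ?addrK //; lia.
Qed.

Theorem lemma1p7 (m : int -> int -> int) (a : int -> int)
    (hm : infinite_frieze m) (ha : a = quiddity_row m) (i j : int)
    (hij : i <= j) :
  ((a j)%:~R = (m i j + m i (j - 2))%:~R / (m i (j - 1))%:~R :> rat /\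
   (a i)%:~R = (m i j + m (i + 2) j)%:~R / (m (i + 1) j)%:~R :> rat) /\
  m i j = \det (tridiag_mx a i `|(j - i + 1)%R|%N).
Proof.
rewrite ha; split; last by rewrite -(frieze_det hm); congr (m i _); lia.
rewrite (frieze_recr hm) // (frieze_recl hm) // !intrM.
by split; rewrite mulfK // intr_eq0; apply: lt0r_neq0;
   apply: (frieze_gt0 hm); lia.
Qed.
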